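(* For all $n\ge1$ and all Dyck paths $\delta$ of length $n$, $\Phi_\delta\in\mathbb{Z}_{>0}[q,t^{\pm1}]\{Q_{n,D}\}_{D\in2^{[n-1]}}$; that is, the modified Dyck path Macdonald function has an expansion $\Phi_\delta=\sum_{D\subseteq[n-1]}c_D(q,t)\,Q_{n,D}$ into Gessel fundamental quasi-symmetric functions in which every $c_D(q,t)$ is a nonzero Laurent polynomial in $\mathbb{Z}[q,t^{\pm1}]$ with non-negative integer coefficients.
   Context: **Dyck graph.** A Dyck path $\delta$ of length $n$ is a lattice path from $(0,0)$ to $(n,n)$ with unit north and east steps staying weakly above $y=x$. $G_\delta$ is the graph on $[n]$ with $i<j$ adjacent iff $(i-1,j)$ is on or below $\delta$. **Dyck path statistics.** Let $\delta$ be a Dyck path of length $n$ with exactly $k$ initial north steps. The column graph $C_\delta$ is the directed graph on $[n]$ with an edge $j\to i$ whenever $i<j$ and $i$ is the largest number less than $j$ with $\{i,j\}$ not an edge of $G_\delta$; then write $d(j)=i$. (So $d(j)$ is defined exactly for $j\ge k+1$.) For $i\ge k+1$, $l(i)$ is the number of $j>i$ having a directed path to $i$ in $C_\delta$. The connected components of $C_\delta$ are the columns, and $\mathrm{ht}(i)$ is the size of the column containing $i$. The bounce path $b_\delta$ starts at $(0,0)$ and successively goes north as far as possible without leaving the region on or below $\delta$, then east to the diagonal, and repeats; it partitions $[n]$ into consecutive intervals (rows) $R_1,\dots,R_r$, the maximal cliques of the Dyck graph of $b_\delta$. $\mathrm{arm}(i)$ is the set of $1\le j<i$ such that either $i,j$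 are in the same row and $\mathrm{ht}(j)\le\mathrm{ht}(i)$, or $i,j$ are adjacent in $G_\delta$, not in the same row, and $\mathrm{ht}(j)<\mathrm{ht}(i)$; $a(i)=|\mathrm{arm}(i)|$. For an arbitrary map $f:[n]\to\mathbb{N}=\{1,2,\dots\}$: $\mathrm{Des}(f)=\{j\ge k+1:f(j)>f(d(j))\}$; $\mathrm{Inv}(f)$ is the set of pairs $i<j$ adjacent in $G_\delta$ with $f(i)<f(j)$; $\mathrm{maj}(f)=\sum_{i\in\mathrm{Des}(f)}(l(i)+1)$; $\mathrm{inv}^*(f)=|\mathrm{Inv}(f)|-\sum_{i\in\mathrm{Des}(f)}a(i)$. **Modified Dyck path Macdonald function.** $\Phi_\delta=\sum_{f:[n]\to\mathbb{N}}q^{\mathrm{maj}(f)}t^{\mathrm{inv}^*(f)}x^f$, the sum over all (not necessarily proper) colorings, with $x^f=\prod_{i=1}^nx_{f(i)}$. **Gessel fundamental quasi-symmetric functions.** For $D\subseteq[n-1]$, $Q_{n,D}=\sum x_{i_1}\cdots x_{i_n}$, summed over $1\le i_1\le\dots\le i_n$ such that $i_j=i_{j+1}$ implies $j\notin D$. *)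

(* Defs.v *)
From HB Require Import structures.
From mathcomp Require Import all_boot all_order all_algebra.
From mathcomp Require Import finmap.
From mathcomp Require Import classical_sets cardinality fsbigop.
From mathcomp Require Import monalg.

Set Implicit Arguments.
Unset Strict Implicit.
Unset Printing Implicit Defensive.

Import Order.TTheory GRing.Theory Num.Theory.
Local Open Scope nat_scope.

(* The vertex set [n] = {1, ..., n} is 'I_n, the ordinal i standing for the
   integer i + 1.  In the same way the colours and the variables x_1, x_2, ...
   are indexed by nat from 0, and the subsets D of [n - 1] are {set 'I_n.-1}. *)

Section DyckPaths.

Definition north : bool := true.
Definition east : bool := false.

(* A lattice path is the list of its steps; the k-th point of s has
   coordinates (xcoord s k, ycoord s k). *)
Implicit Type s : seq bool.

Definition xcoord s (k : nat) : nat := count_mem east (take k s).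
Definition ycoord s (k : nat) : nat := count_mem north (take k s).

Definition dyck_path (n : nat) s : bool :=
  [&& count_mem north s == n, count_mem east s == n
    & [forall k : 'I_(size s).+1, xcoord s k <= ycoord s k]].

Definition on_or_below s (x y : nat) : bool :=
  [exists k : 'I_(size s).+1, (xcoord s k == x) && (y <= ycoord s k)].

Definition initial_norths s : nat := find (pred1 east) s.

(* For i < j the point (i - 1, j) of the 1-based convention is (i, j.+1). *)
Definition dyck_graph (n : nat) s : rel 'I_n := fun i j =>
  ((i < j) && on_or_below s i j.+1) || ((j < i) && on_or_below s j i.+1).

(* Height reached from (p, p) by going north inside the region. *)
Definition bounce_height (n : nat) s (p : nat) : nat :=
  \max_(y < n.+1 | on_or_below s p y) y.

(* Each bounce goes at least one unit north, hence fuel n is enough. *)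
Fixpoint bounce_from (n : nat) s (fuel p : nat) : seq bool :=
  if fuel is fuel'.+1 then
    if p < n then
      let h := bounce_height n s p in
      nseq (h - p) north ++ nseq (h - p) east ++ bounce_from n s fuel' h
    else [::]
  else [::].

Definition bounce_path (n : nat) s : seq bool := bounce_from n s n 0.

End DyckPaths.

Section Statistics.

Variables (n : nat) (s : seq bool).
Implicit Types (i j : 'I_n) (f : {ffun 'I_n -> nat}).

Local Notation G := (@dyck_graph n s).

Definition nonadj_below j : pred 'I_n := fun i => (i < j) && ~~ G i j.

Definition col_pred j : option 'I_n :=
  [pick i | nonadj_below j i & [forall i', nonadj_below j i' ==> (i' <= i)]].

Definition col_graph : rel 'I_n := fun j i => col_pred j == Some i.

Definition leg i : nat := #|[set j : 'I_n | (i < j) && connect col_graph j i]|.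

(* Weakly connected components of the directed graph. *)
Definition column i : {set 'I_n} :=
  [set j | connect (fun x y => col_graph x y || col_graph y x) i j].

Definition ht i : nat := #|column i|.

Definition clique (e : rel 'I_n) : pred {set 'I_n} := fun A =>
  [forall x in A, forall y in A, (x != y) ==> e x y].

Definition rows : {set {set 'I_n}} :=
  [set A | maxset (clique (dyck_graph (bounce_path n s))) A].

Definition same_row i j : bool := [exists A in rows, (i \in A) && (j \in A)].

Definition arm i : {set 'I_n} :=
  [set j : 'I_n | (j < i) &&
     ((same_row i j && (ht j <= ht i))
      || [&& G i j, ~~ same_row i j & ht j < ht i])].

Definition arm_size i : nat := #|arm i|.

Definition Des f : {set 'I_n} :=
  [set j : 'I_n | (initial_norths s <= j) &&
     (if col_pred j is Some i then f i < f j else false)].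

Definition Inv f : {set 'I_n * 'I_n} :=
  [set p : 'I_n * 'I_n | [&& p.1 < p.2, G p.1 p.2 & f p.1 < f p.2]].

Definition maj f : nat := \sum_(i in Des f) (leg i).+1.

Definition inv_star f : int :=
  ((#|Inv f|)%:Z - (\sum_(i in Des f) arm_size i)%:Z)%R.

End Statistics.

Section Laurent.
Local Open Scope ring_scope.

(* The field Q(q, t), as the fraction field of Z[q][t]; it contains the ring
   of Laurent polynomials Z[q, t^{+-1}]. *)
Definition Qqt : fieldType := {fraction {poly {poly int}}}.

Definition q_var : Qqt := FracField.tofrac ('X%:P : {poly {poly int}}).
Definition t_var : Qqt := FracField.tofrac ('X : {poly {poly int}}).

(* Z_{>0}[q, t^{+-1}]: nonzero elements p(q, t) / t^e, where all the
   coefficients of p are nonnegative. *)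
Definition pos_laurent (c : Qqt) : Prop :=
  c != 0 /\
  exists (p : {poly {poly int}}) (e : nat),
    (forall i j : nat, 0 <= p`_i`_j) /\ c = FracField.tofrac p / t_var ^+ e.

End Laurent.

Section Series.
Local Open Scope classical_set_scope.
Local Open Scope ring_scope.

(* Formal power series in x_0, x_1, ... over Q(q, t), given by their
   coefficients. *)
Definition series : Type := {cmonom nat} -> Qqt.

Variable n : nat.
Implicit Type f : {ffun 'I_n -> nat}.

Definition xpow f : {cmonom nat} := \big[mmul/mone]_(i < n) ucm (f i).

(* The formal sum of w f * x^f over f in A.  By finite_xpow_fiber below, each
   coefficient is a finite sum. *)
Definition word_series (A : set {ffun 'I_n -> nat})
    (w : {ffun 'I_n -> nat} -> Qqt) : series :=
  fun m => \sum_(f \in A `&` [set f | xpow f = m]) w f.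

Definition Phi (s : seq bool) : series :=
  word_series setT (fun f => q_var ^+ maj s f * t_var ^ inv_star s f).

(* The ordinal j : 'I_n.-1 stands for the pair of consecutive positions
   a = j and b = j + 1 of 'I_n. *)
Definition gessel_word (D : {set 'I_n.-1}) : set {ffun 'I_n -> nat} :=
  [set f | (forall a b : 'I_n, (a <= b)%N -> (f a <= f b)%N) /\
           (forall (j : 'I_n.-1) (a b : 'I_n),
              a = j :> nat -> b = j.+1 :> nat -> f a = f b -> j \notin D)].

Definition Qfund (D : {set 'I_n.-1}) : series :=
  word_series (gessel_word D) (fun=> 1).

End Series.

Lemma finite_xpow_fiber (n : nat) (m : {cmonom nat}) :
  finite_set [set f : {ffun 'I_n -> nat} | xpow f = m]%classic.
Proof.
pose N := \max_(c <- finsupp m) c.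
pose up (g : {ffun 'I_n -> 'I_N.+1}) : {ffun 'I_n -> nat} :=
  [ffun i => g i : nat].
apply: (@sub_finite_set _ _ (up @` setT)%classic); last first.
  by apply: finite_image; exact: finite_finset.
move=> f /= fm; have fN i : f i < N.+1.
  rewrite ltnS; apply: leq_bigmax_seq => //.
  rewrite -cmE_neq0 -fm /xpow (bigD1 i) //= cmM -lt0n.
  by rewrite (cmUU (f i)).
exists [ffun i => Ordinal (fN i)] => //.
by apply/ffunP => i; rewrite !ffunE.
Qed.

(* Main.v *)
(** Every word [f] has a standardization: the permutation numbering the
    positions by increasing letter, and from right to left among equal letters.
    Both [Inv] and [Des] only test strict increases [f i < f j] with [i < j],
    which equal letters numbered from right to left do not create, so [maj] and
    [inv_star] take the same value on [f] and on its standardization [u].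
    Reading the words with standardization [u] in the order prescribed by [u]
    gives exactly the words counted by [Q_{n,D}], where [D] is the set of ascents
    of the inverse of [u]: at an ascent the numbering forbids equal letters.
    Hence [c_D] is the sum of [q^maj t^inv*] over the permutations [u] with set
    [D], and every [D] comes from at least one permutation. *)
Require Import Defs.
From mathcomp Require Import finmap classical_sets functions cardinality fsbigop.
From mathcomp Require Import all_boot all_order all_algebra perm monalg.

Import GRing.Theory Num.Theory.

(** * Standardization of words *)

Definition std_lt {n} (f : 'I_n -> nat) : rel 'I_n :=
  fun i j => (f i < f j) || (f i == f j) && (j < i).

Lemma std_lt_irr {n} (f : 'I_n -> nat) : irreflexive (std_lt f).
Proof. by move=> i; rewrite /std_lt !ltnn andbF. Qed.

Lemma std_lt_trans {n} (f : 'I_n -> nat) : transitive (std_lt f).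
Proof.
move=> j i k /orP[ij|/andP[/eqP ij ji]] /orP[jk|/andP[/eqP jk kj]]; apply/orP.
- by left; apply: ltn_trans jk.
- by left; rewrite -jk.
- by left; rewrite ij.
- by right; rewrite ij jk eqxx (ltn_trans kj ji).
Qed.

Lemma std_lt_total {n} (f : 'I_n -> nat) (i j : 'I_n) :
  i != j -> std_lt f i j || std_lt f j i.
Proof.
rewrite -val_eqE /std_lt /= => ij.
by case: (ltngtP (f i) (f j)) => //= _; rewrite orbC -neq_ltn.
Qed.

Lemma std_lt_below {n} (f : 'I_n -> nat) (i j : 'I_n) :
  i < j -> std_lt f i j = (f i < f j).
Proof. by move=> ij; rewrite /std_lt [j < i]ltnNge (ltnW ij) andbF orbF. Qed.

Definition std_rank {n} (f : 'I_n -> nat) (i : 'I_n) : nat :=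
  #|[set j | std_lt f j i]|.

Lemma std_rank_lt_n {n} (f : 'I_n -> nat) (i : 'I_n) : std_rank f i < n.
Proof.
rewrite -[X in _ < X]card_ord -cardsT; apply: proper_card.
by apply/properP; split; [exact: subsetT | exists i; rewrite inE ?std_lt_irr].
Qed.

Lemma std_rank_homo {n} (f : 'I_n -> nat) (i j : 'I_n) :
  std_lt f i j -> std_rank f i < std_rank f j.
Proof.
move=> ij; apply: proper_card; apply/properP; split.
  by apply/subsetP => k; rewrite !inE => ki; apply: std_lt_trans ij.
by exists i; rewrite inE ?std_lt_irr.
Qed.

Lemma std_rank_mono {n} (f : 'I_n -> nat) (i j : 'I_n) :
  (std_rank f i < std_rank f j) = std_lt f i j.
Proof.
apply/idP/idP => [ij|]; last exact: std_rank_homo.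
have /(std_lt_total f)/orP[//|ji] : i != j.
  by apply: contraTneq ij => ->; rewrite ltnn.
by move: (ltn_trans ij (std_rank_homo _ _ _ ji)); rewrite ltnn.
Qed.

Definition std_fun {n} (f : 'I_n -> nat) (i : 'I_n) : 'I_n :=
  Ordinal (std_rank_lt_n f i).

Lemma std_fun_inj {n} (f : 'I_n -> nat) : injective (std_fun f).
Proof.
move=> i j /(congr1 val)/= eq_ij; apply/eqP.
apply: contra_eqT eq_ij => /(std_lt_total f).
by rewrite -!std_rank_mono -neq_ltn.
Qed.

Definition std {n} (f : 'I_n -> nat) : {perm 'I_n} := perm (@std_fun_inj n f).

Lemma std_mono {n} (f : 'I_n -> nat) (i j : 'I_n) :
  (std f i < std f j) = std_lt f i j.
Proof. by rewrite !permE std_rank_mono. Qed.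

(** One implication suffices because both relations are strict total orders, so inclusion forces
    equality. *)
Lemma std_unique {n} (f : 'I_n -> nat) (u : {perm 'I_n}) :
  (forall i j, u i < u j -> std_lt f i j) -> std f = u.
Proof.
move=> u_homo.
have u_mono i j : (u i < u j) = std_lt f i j.
  apply/idP/idP => [/u_homo//|ij]; rewrite ltnNge leq_eqVlt; apply/norP; split.
    apply: contraTN ij => /eqP/val_inj/perm_inj ->.
    by rewrite std_lt_irr.
  apply/negP => /u_homo ji.
  by move: (std_lt_trans _ _ _ _ ij ji); rewrite std_lt_irr.
apply/permP => i; apply/val_inj; rewrite permE /= /std_rank.
(* The rank of [i] is the size of the preimage under [u] of an initial segment of length [u i]. *)
have -> : [set j | std_lt f j i] = u @^-1: [set k : 'I_n | k < u i].
  by apply/setP => j; rewrite !inE u_mono.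
rewrite card_preimset; last exact: perm_inj.
rewrite -sum1dep_card -(big_ord_widen n (fun=> 1)) ?sum1_card ?card_ord //.
exact: ltnW.
Qed.

(** * Gessel words and inverse ascents *)

Definition lower {n} (p : 'I_n.-1) : 'I_n := widen_ord (leq_pred n) p.

Lemma upper_subproof {n} (p : 'I_n.-1) : p.+1 < n.
Proof. by rewrite -ltn_predRL. Qed.

Definition upper {n} (p : 'I_n.-1) : 'I_n := Ordinal (upper_subproof p).

Definition ascents_inv {n} (u : {perm 'I_n}) : {set 'I_n.-1} :=
  [set p | u^-1%g (lower p) < u^-1%g (upper p)].

(** With [u] the inverse of [std f], this is the weakly increasing rearrangement of [f]. *)
Definition along {n} (u : {perm 'I_n}) (f : {ffun 'I_n -> nat}) :
  {ffun 'I_n -> nat} := [ffun i => f (u i)].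

Lemma xpow_along {n} (u : {perm 'I_n}) (f : {ffun 'I_n -> nat}) :
  xpow (along u f) = xpow f.
Proof.
rewrite /xpow [RHS](reindex_inj (@perm_inj _ u)) /=.
by apply: eq_bigr => i _; rewrite ffunE.
Qed.

(** Equal letters are numbered from right to left, so a tie between consecutive ranks is a descent
    of the inverse. *)
Lemma gessel_word_std {n} (f : {ffun 'I_n -> nat}) :
  gessel_word (ascents_inv (std f)) (along (std f)^-1 f).
Proof.
split=> [a b|p a b ap bp].
  rewrite !ffunE; apply: contraTT; rewrite -!ltnNge => ba.
  by rewrite -[a](permKV (std f)) -[b](permKV (std f)) std_mono /std_lt ba.
have {ap}-> : a = lower p by apply: val_inj.
have {bp}-> : b = upper p by apply: val_inj.
rewrite !ffunE => tie; rewrite inE -leqNgt.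
have : std f ((std f)^-1%g (lower p)) < std f ((std f)^-1%g (upper p)).
  by rewrite !permKV.
by rewrite std_mono /std_lt tie ltnn eqxx /= => /ltnW.
Qed.

(** By transitivity only consecutive values matter: there [g] either increases strictly or has a
    tie, which rules out an ascent and so gives the right-to-left order that breaks ties. *)
Lemma std_along_gessel_word {n} (u : {perm 'I_n}) (g : {ffun 'I_n -> nat}) :
  gessel_word (ascents_inv u) g -> std (along u g) = u.
Proof.
move=> [g_mono g_strict]; apply: std_unique.
suff consec (a b : 'I_n) : a < b ->
    std_lt (along u g) (u^-1%g a) (u^-1%g b).
  by move=> i j /consec; rewrite !permK.
(* Induction on [b - a], splitting off the last step from [b - 1] to [b]. *)
have [m] := ubnP (b - a); elim: m b => // m IHm b ba_m ab.
have b_gt0 : 0 < b by apply: leq_ltn_trans ab.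
have p_lt : b.-1 < n.-1 by rewrite ltn_predRL prednK.
pose p := Ordinal p_lt.
have bE : b = upper p by apply: val_inj; rewrite /= prednK.
have step : std_lt (along u g) (u^-1%g (lower p)) (u^-1%g b).
  rewrite /std_lt !ffunE !permKV bE.
  have /g_mono : lower p <= upper p by exact: leqnSn.
  rewrite leq_eqVlt => /orP[tie|->//]; rewrite tie /=; apply/orP; right.
  have := g_strict p (lower p) (upper p) erefl erefl (eqP tie).
  rewrite inE -leqNgt leq_eqVlt => /orP[|//].
  by move=> /eqP/val_inj/perm_inj/(congr1 val)/esym/n_Sn.
have [aE|a_neq] := eqVneq a (lower p); first by rewrite aE.
apply: std_lt_trans step; apply: IHm.
  rewrite ltnS in ba_m; apply: leq_trans ba_m.
  by rewrite /= ltn_sub2r // prednK.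
rewrite ltn_neqAle; apply/andP; split; first by rewrite val_eqE.
by rewrite /= -ltnS prednK.
Qed.

Lemma ascents_inv_surj {n} (D : {set 'I_n.-1}) : exists u, ascents_inv u = D.
Proof.
(* This weakly increasing word jumps between [p] and [p + 1] exactly when [p] is in [D], and
   standardization keeps its strict increases. *)
pose h (i : 'I_n) : nat := #|[set p in D | p < i]|.
exists (std h)^-1%g; apply/setP => p; rewrite inE invgK std_mono.
rewrite std_lt_below ?ltnSn // /h.
have [pD|pD] := boolP (p \in D).
  apply: proper_card; apply/properP; split.
    by apply/subsetP => k; rewrite !inE => /andP[-> /= /ltnW].
  by exists p; rewrite !inE pD /= ?ltnn.
apply/negbTE; rewrite -leqNgt; apply: subset_leq_card.
apply/subsetP => k; rewrite !inE /= => /andP[kD].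
rewrite kD ltnS leq_eqVlt => /orP[/eqP/val_inj kp|//].
by rewrite -kp kD in pD.
Qed.

(** * Invariance of the statistics under standardization *)

Section SameStatistics.
Context {n : nat} (s : seq bool) (f g : {ffun 'I_n -> nat}).
Hypothesis same_lt : forall i j : 'I_n, i < j -> (f i < f j) = (g i < g j).

Lemma eq_Des : Des s f = Des s g.
Proof.
apply/setP => j; rewrite !inE /col_pred.
(* The vertex [col_pred j] lies below [j], so [same_lt] applies. *)
by case: pickP => // i /andP[/andP[ij _] _]; rewrite same_lt.
Qed.

Lemma eq_Inv : Defs.Inv s f = Defs.Inv s g.
Proof.
apply/setP => -[i j]; rewrite !inE /=.
by case: ltnP => //= ij; rewrite same_lt.
Qed.

End SameStatistics.

Definition perm_word {n} (u : {perm 'I_n}) : {ffun 'I_n -> nat} :=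
  [ffun i => u i : nat].

Lemma perm_word_std_lt {n} (f : {ffun 'I_n -> nat}) (i j : 'I_n) :
  i < j -> (f i < f j) = (perm_word (std f) i < perm_word (std f) j).
Proof. by move=> ij; rewrite !ffunE std_mono std_lt_below. Qed.

Local Open Scope ring_scope.

Definition weight {n} (s : seq bool) (f : {ffun 'I_n -> nat}) : Qqt :=
  q_var ^+ maj s f * t_var ^ inv_star s f.

Lemma weight_std {n} (s : seq bool) (f : {ffun 'I_n -> nat}) :
  weight s (perm_word (std f)) = weight s f.
Proof.
rewrite /weight /maj /inv_star.
by rewrite (eq_Des s _ _ (perm_word_std_lt f)) (eq_Inv s _ _ (perm_word_std_lt f)).
Qed.

(** * Positivity of Laurent polynomials *)

Definition nonneg_coefs (p : {poly {poly int}}) : Prop :=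
  forall i j : nat, 0 <= p`_i`_j.

Lemma nonneg_coefsD p r :
  nonneg_coefs p -> nonneg_coefs r -> nonneg_coefs (p + r).
Proof. by move=> p0 r0 i j; rewrite !coefD addr_ge0. Qed.

Lemma nonneg_coefsM p r :
  nonneg_coefs p -> nonneg_coefs r -> nonneg_coefs (p * r).
Proof.
move=> p0 r0 i j; rewrite coefM coef_sum; apply: sumr_ge0 => k _.
by rewrite coefM; apply: sumr_ge0 => l _; rewrite mulr_ge0.
Qed.

Lemma nonneg_coefs_mono a b : nonneg_coefs (('X^a)%:P * 'X^b).
Proof.
move=> i j; rewrite mulrC coefXnM; case: ifP => _; first by rewrite coef0.
rewrite coefC; case: ifP => _; last by rewrite coef0.
by rewrite coefXn ler0n.
Qed.

Lemma nonneg_coefs_add_eq0 p r :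
  nonneg_coefs p -> nonneg_coefs r -> p + r = 0 -> p = 0.
Proof.
move=> p0 r0 pr; apply/polyP => i; apply/polyP => j; rewrite !coef0.
have /(congr1 (fun z : {poly {poly int}} => z`_i`_j)) := pr.
by rewrite !coefD !coef0 => /eqP; rewrite paddr_eq0 // => /andP[/eqP].
Qed.

Definition nonneg_laurent (c : Qqt) : Prop :=
  exists (p : {poly {poly int}}) (e : nat),
    nonneg_coefs p /\ c = FracField.tofrac p / t_var ^+ e.

Lemma t_var_neq0 : t_var != 0.
Proof. by rewrite tofrac_eq0 polyX_eq0. Qed.

Lemma nonneg_coefsMXn p m : nonneg_coefs p -> nonneg_coefs (p * 'X^m).
Proof.
move=> p0; apply: nonneg_coefsM => //.
by rewrite -['X^m]mul1r -[1]/(('X^0)%:P); exact: nonneg_coefs_mono.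
Qed.

Lemma laurent_add (p r : {poly {poly int}}) (e k : nat) :
  FracField.tofrac p / t_var ^+ e + FracField.tofrac r / t_var ^+ k =
  FracField.tofrac (p * 'X^k + r * 'X^e) / t_var ^+ (e + k).
Proof.
rewrite addf_div ?expf_neq0 ?t_var_neq0 // exprD.
by rewrite tofracD !tofracM !tofracXn.
Qed.

Lemma nonneg_laurentD c d :
  nonneg_laurent c -> nonneg_laurent d -> nonneg_laurent (c + d).
Proof.
move=> [p [e [p0 ->]]] [r [k [r0 ->]]].
exists (p * 'X^k + r * 'X^e), (e + k)%N; split; last exact: laurent_add.
by apply: nonneg_coefsD; apply: nonneg_coefsMXn.
Qed.

(** Over a common denominator, numerators with non-negative coefficients cannot cancel. *)
Lemma pos_laurentD c d : pos_laurent c -> nonneg_laurent d -> pos_laurent (c + d).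
Proof.
move=> [c_neq0 c_ge0] d_ge0; split; last exact: nonneg_laurentD.
case: c_ge0 d_ge0 c_neq0 => [p [e [p0 ->]]] [r [k [r0 ->]]].
rewrite laurent_add; apply: contra_neq => /eqP.
rewrite mulf_eq0 invr_eq0 expf_eq0 (negbTE t_var_neq0) andbF orbF tofrac_eq0.
have := nonneg_coefs_add_eq0 _ _ (nonneg_coefsMXn p k p0) (nonneg_coefsMXn r e r0).
move=> add_eq0 /eqP/add_eq0/eqP.
by rewrite mulf_eq0 expf_eq0 polyX_eq0 andbF orbF => /eqP->; rewrite tofrac0 mul0r.
Qed.

Lemma pos_laurent_weight {n} (s : seq bool) (f : {ffun 'I_n -> nat}) :
  pos_laurent (weight s f).
Proof.
have q_neq0 : q_var != 0 by rewrite tofrac_eq0 polyC_eq0 polyX_eq0.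
split.
  by apply: mulf_neq0; [exact: expf_neq0 | exact: expfz_neq0 t_var_neq0].
rewrite /weight; case: (inv_star s f) => e.
  exists (('X^(maj s f))%:P * 'X^e), 0%N; split; first exact: nonneg_coefs_mono.
  by rewrite expr0 divr1 tofracM tofracXn rmorphXn tofracXn.
(* Here [inv_star s f] is [-(e + 1)], so the power of [t] goes to the denominator. *)
exists (('X^(maj s f))%:P * 'X^0), e.+1; split; first exact: nonneg_coefs_mono.
by rewrite expr0 mulr1 rmorphXn tofracXn.
Qed.

Lemma nonneg_laurent_weight {n} (s : seq bool) (f : {ffun 'I_n -> nat}) :
  nonneg_laurent (weight s f).
Proof. by case: (pos_laurent_weight s f). Qed.

Lemma nonneg_laurent0 : nonneg_laurent 0.
Proof.
by exists 0, 0%N; split=> [i j|]; rewrite ?coef0 // tofrac0 mul0r.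
Qed.

Lemma pos_laurent_coef {n} (s : seq bool) (D : {set 'I_n.-1}) :
  pos_laurent (\sum_(u | ascents_inv u == D) weight s (perm_word u)).
Proof.
have [u0 <-] := ascents_inv_surj D.
rewrite (bigD1 u0) //=; apply: pos_laurentD; first exact: pos_laurent_weight.
apply: big_ind => [||u _]; [exact: nonneg_laurent0 | exact: nonneg_laurentD |].
exact: nonneg_laurent_weight.
Qed.

(** * Splitting the series by standardization *)

Lemma word_series_split {n} {T : finType} (p : {ffun 'I_n -> nat} -> T)
    (w : {ffun 'I_n -> nat} -> Qqt) (m : {cmonom nat}) :
  word_series classical_sets.setT w m =
  \sum_(u : T) word_series (p @^-1` [set u])%classic w m.
Proof.
rewrite /word_series classical_sets.setTI fsbig_finite /=; last exact: finite_xpow_fiber.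
rewrite (partition_big p xpredT) //=; apply: eq_bigr => u _.
rewrite fsbig_mkcondl fsbig_finite /=; last exact: finite_xpow_fiber.
rewrite big_mkcond; apply: eq_bigr => f _.
by congr (if _ then _ else _); apply/eqP/idP; rewrite in_setE.
Qed.

(** Reindexing by the monomial-preserving bijection [along u], whose inverse is [along u^-1]. *)
Lemma word_series_std {n} (u : {perm 'I_n})
    (w : {ffun 'I_n -> nat} -> Qqt) (m : {cmonom nat}) :
  word_series ((fun f : {ffun 'I_n -> nat} => std f) @^-1` [set u])%classic w m =
  word_series (gessel_word (ascents_inv u)) (fun g => w (along u g)) m.
Proof.
rewrite /word_series; apply: reindex_fsbig; split.
- move=> g [/std_along_gessel_word gu gm]; split=> //=.
  by rewrite xpow_along.
- move=> g1 g2 _ _ /ffunP eq_g; apply/ffunP => i.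
  by have := eq_g (u^-1%g i); rewrite !ffunE permKV.
- move=> f [/= fu fm]; exists (along u^-1 f).
    by split; rewrite -?fu /= ?xpow_along //; exact: gessel_word_std.
  by apply/ffunP => i; rewrite !ffunE permK.
Qed.

Lemma Phi_sum_perm {n} (s : seq bool) (m : {cmonom nat}) :
  Phi n s m =
  \sum_(u : {perm 'I_n}) weight s (perm_word u) * Qfund (ascents_inv u) m.
Proof.
rewrite /Phi (word_series_split (fun f : {ffun 'I_n -> nat} => std f)).
apply: eq_bigr => u _; rewrite word_series_std /Qfund /word_series.
have fin : finite_set (gessel_word (ascents_inv u) `&` [set f | xpow f = m])%classic.
  by apply: sub_finite_set (finite_xpow_fiber n m) => f [].
rewrite !fsbig_finite //= mulr_sumr big_seq [RHS]big_seq.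
(* Since [along u g] standardizes to [u], its weight is that of [perm_word u], independent of
   [g]. *)
apply: eq_bigr => g; rewrite in_fset_set // in_setE => -[/std_along_gessel_word gu _].
by rewrite mulr1 -[X in perm_word X]gu weight_std.
Qed.

Local Close Scope ring_scope.

Theorem proposition6p8 (n : nat) (hn : 0 < n) (delta : seq bool)
    (hdelta : dyck_path n delta) :
  exists c : {set 'I_n.-1} -> Qqt,
    (forall D : {set 'I_n.-1}, pos_laurent (c D)) /\
    (forall m : {cmonom nat},
       Phi n delta m = (\sum_(D : {set 'I_n.-1}) c D * Qfund D m)%R).
Proof.
exists (fun D => \sum_(u | ascents_inv u == D) weight delta (perm_word u))%R.
split=> [D|m]; first exact: pos_laurent_coef.
rewrite Phi_sum_perm (partition_big (@ascents_inv n) xpredT) //=.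
apply: eq_bigr => D _; rewrite mulr_suml.
by apply: eq_bigr => u /eqP ->.
Qed.
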